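(* Let $X$ be a $\Pi$-separable space, $Y$ a space such that $Y\times Y$ is countably compact, $Z$ a pseudo-metric space, and $X_o$ a non-void open subset of $X$. If $f\colon X_o\times Y\to Z$ is a separately continuous mapping, then there exists a residual set $R$ in $X_o$ such that $f$ is jointly continuous at each point of $R\times Y$.
   Context: No separation axioms are assumed. A space is $\Pi$-separable if it is homeomorphic to the product of a family of separable spaces. A space is countably compact if every countable open cover has a finite subcover. A subset of a space is meager if it is a countable union of sets whose closures have empty interior; residual means having meager complement. A map of two variables is separately continuous if it is continuous in each variable when the other is fixed. *)

(* Defs.v *)
From mathcomp Require Import all_boot all_order all_algebra.
From mathcomp Require Import all_classical all_reals all_analysis.

Set Implicit Arguments.
Unset Strict Implicit.
Unset Printing Implicit Defensive.

Local Open Scope classical_set_scope.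

Definition separable (T : topologicalType) : Prop :=
  exists2 D : set T, countable D & dense D.

Definition homeomorphic (S T : topologicalType) : Prop :=
  exists (f : S -> T) (g : T -> S),
    [/\ continuous f, continuous g, cancel f g & cancel g f].

Definition pi_separable (T : topologicalType) : Prop :=
  exists (I : Type) (S : I -> topologicalType),
    (forall i, separable (S i)) /\ homeomorphic T (prod_topology S).

(* This is [cover_compact [set: T]] with the index set required to be
   countable. *)
Definition countably_compact (T : topologicalType) : Prop :=
  forall (I : choiceType) (D : set I) (U : I -> set T),
    countable D -> (forall i, D i -> open (U i)) ->
    [set: T] `<=` cover D U -> finite_subset_cover D U [set: T].

Definition nowhere_dense (T : topologicalType) (A : set T) : Prop :=
  (closure A)° = set0.

(* Finite and empty unions are covered as well, since [set0] is nowhere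
   dense. *)
Definition meager (T : topologicalType) (A : set T) : Prop :=
  exists2 F : nat -> set T,
    (forall n, nowhere_dense (F n)) & A = \bigcup_n F n.

Definition residual (T : topologicalType) (A : set T) : Prop :=
  meager (~` A).

Definition separately_continuous (S T U : topologicalType) (f : S * T -> U) :
    Prop :=
  (forall y : T, continuous (fun x : S => f (x, y))) /\
  (forall x : S, continuous (fun y : T => f (x, y))).

(* Main.v *)
Require Import Defs.
From mathcomp Require Import all_boot all_order all_algebra.
From mathcomp Require Import all_classical all_reals all_analysis.
From mathcomp Require Import lra.

Set Implicit Arguments.
Unset Strict Implicit.
Unset Printing Implicit Defensive.

Import Order.TTheory Num.Theory.

Local Open Scope classical_set_scope.

(** Call an open set [V] of the first variable small when every [y] has a
    neighbourhood [W] such that [f] varies by at most a given [e] on [V * W].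
    For fixed [e] the union of the small open sets is open.  If it is shown that
    every nonmeager open set contains a nonempty small open set, then the
    interior of the complement of that union is meager (it is an open set without
    nonempty small open subsets), hence the complement itself is; intersecting
    over [e = 10 / (n + 1)] gives the residual set.

    So let [O] be open and nonmeager, and suppose it has no nonempty small open
    subset.  By [exists_separating_pair], given any finite set [F] of points,
    any [r > 0] and any nonempty open [W] inside [O], there is a pair [(y, y')]
    that [f] separates by at most [r] along [F] but by at least some fixed [d]
    along a nonempty open subset of [W].  Otherwise, countable compactness gives
    finitely many points of [Y] such that every point of [Y] is [r]-close along
    [F] to one of them, and any point of [W] would have a small neighbourhood.

    This is a move in a Banach-Mazur game.  Iterate it: at stage [n] shrink the
    open set so that it depends on a finite set [J n] of coordinates of the
    product only, and take for [F] a finite grid of points that have coordinates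
    in countable dense sets on [J n] and agree with a base point [a] elsewhere.
    Because [O] is not meager, [nonmeager_play] gives a run of the game whose
    open sets have a common point [x].  Changing [x] into [a] outside the
    countable set of coordinates that were ever used yields a point [x'] which is
    still in all these open sets and is moreover adherent to the union of the
    grids ([grid_dense]).  The pairs produced along the run have a cluster point
    [(y, y')] in [Y * Y].  Then [f (_, y)] and [f (_, y')] are at distance [0] on
    the grids, hence at [x']; but every pair of the run takes values at distance at
    least [d] at [x'], which is a contradiction. *)

(** * Filters and meager sets *)

Lemma near_finite_set (I : choiceType) (T : Type) (F : set_system T)
    (D : set I) (P : I -> T -> Prop) :
  Filter F -> finite_set D ->
  (forall i, D i -> \forall x \near F, P i x) ->
  \forall x \near F, forall i, D i -> P i x.
Proof.
move=> FF /finite_fsetP[E ->] FP.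
exact: (@filter_bigI T I E P F FF FP).
Qed.

Lemma meagerS (T : topologicalType) (A B : set T) :
  A `<=` B -> meager B -> meager A.
Proof.
move=> AB [F Fnd BF]; exists (fun n => F n `&` A) => [n|].
  rewrite /nowhere_dense -subset0 -(Fnd n).
  by apply: interiorS; apply: closure_subset => x [].
by rewrite -setI_bigcupl -BF setIC; apply/esym/setIidPl.
Qed.

Lemma meager_bigcup (T : topologicalType) (A : nat -> set T) :
  (forall n, meager (A n)) -> meager (\bigcup_n A n).
Proof.
move=> /(_ _)/cid2-/all_sig2/= H.
have [F Fnd AF] : exists2 F : nat -> nat -> set T,
    (forall n k, nowhere_dense (F n k)) & forall n, A n = \bigcup_k F n k.
  by case: H => F FP AF; exists F.
exists (fun m =>
    if @unpickle (nat * nat)%type m is Some p then F p.1 p.2 else set0) => [m|].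
  case: (@unpickle (nat * nat)%type m) => [p|]; first exact: Fnd.
  by rewrite /nowhere_dense closure0 interior0.
apply/seteqP; split=> [x [n _]|x [m _]].
  rewrite AF => -[k _ Fx]; exists (pickle (n, k)) => //.
  by rewrite pickleK.
case: (@unpickle (nat * nat)%type m) => [p Fx|//]; exists p.1 => //.
by rewrite AF; exists p.2.
Qed.

Lemma nowhere_dense_meager (T : topologicalType) (A : set T) :
  nowhere_dense A -> meager A.
Proof.
by move=> And; exists (fun=> A); rewrite ?bigcup_const//; exists 0%N.
Qed.

Lemma meagerU (T : topologicalType) (A B : set T) :
  meager A -> meager B -> meager (A `|` B).
Proof.
move=> mA mB; rewrite -bigcup2E; apply: meager_bigcup => -[|[|n]] //=.
by apply: nowhere_dense_meager; rewrite /nowhere_dense closure0 interior0.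
Qed.

(** The boundary of a closed set is nowhere dense. *)
Lemma closed_meager_interior (T : topologicalType) (B : set T) :
  closed B -> meager B° -> meager B.
Proof.
move=> cB mB; apply: (@meagerS _ _ (B° `|` (B `\` B°))).
  by move=> x Bx; have [|] := pselect (B° x); [left|right].
apply: meagerU => //; apply: nowhere_dense_meager.
rewrite /nowhere_dense -subset0 => x.
have cl : closure (B `\` B°) `<=` B `\` B°.
  have : closed (B `\` B°).
    by rewrite setDE; apply: closedI => //; exact/open_closedC/open_interior.
  by move/closure_id => <-.
move=> /(interiorS cl) Ux.
have : (B `\` B°) x by apply: interior_subset.
case=> _; apply; move: Ux; apply: filterS => y []//.
Qed.

(** * Countable compactness *)

(** Without a cluster point, the complements of the closures of the tails of [u]
    would be an increasing countable open cover, and a finite subcover would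
    reduce to a single complement, which misses a term of [u]. *)
Lemma countably_compact_cluster (T : topologicalType) (u : nat -> T) :
  countably_compact T ->
  exists t : T, forall N : set T, nbhs t N -> forall m, exists2 n,
    (m <= n)%N & N (u n).
Proof.
move=> Tc.
pose C m := closure [set u n | n in [set n | (m <= n)%N]].
have [[t tC]|noC] := pselect (exists t, forall m, C m t).
  exists t => N Nt m; have [_ [[n mn <-] Nu]] := tC m _ Nt.
  by exists n.
have := Tc nat setT (fun m => ~` C m) (countableP _).
case.
- by move=> m _; exact/closed_openC/closed_closure.
- move=> t _; apply: contrapT => tU; apply: noC; exists t => m.
  by apply: contrapT => ?; apply: tU; exists m.
move=> D _ DU; exfalso; pose M := (\max_(m <- finmap.enum_fset D) m)%N.
have [m /= mD] := DU (u M) I; apply; apply: subset_closure; exists M => //=.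
by rewrite /M; apply: leq_bigmax_seq.
Qed.

Lemma countably_compact_fst (S : topologicalType) :
  countably_compact (S * S)%type -> countably_compact S.
Proof.
move=> Sc J D U cD oU covU.
have [] := Sc J D (fun i => fst @^-1` U i) cD.
- move=> i Di; apply: open_comp (oU i Di) => p _; exact: cvg_fst.
- by move=> p _; have [i Di Ui] := covU p.1 I; exists i.
move=> D' D'D cov; exists D' => // s _.
by have [i Di Ui] := cov (s, s) Logic.I; exists i.
Qed.

(** A relation holding between any two points close enough to a common point
    admits finite nets: failing that, one builds a sequence no two terms of which
    are related, and such a sequence cannot cluster. *)
Lemma countably_compact_finite_net (T : topologicalType) (E : T -> T -> Prop) :
  countably_compact T ->
  (forall t : T, exists2 N : set T, nbhs t N & forall a b, N a -> N b -> E a b) ->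
  exists2 A : set T, finite_set A & forall t, exists2 a, A a & E a t.
Proof.
move=> Tc EN; apply: contrapT => noA.
have next (A : set T) : {t | finite_set A -> forall a, A a -> ~ E a t}.
  apply: cid; apply: contrapT => not; apply: noA.
  have [fA|nfA] := pselect (finite_set A); last first.
    (* Any point will do for an infinite [A]; if there were none, the empty set
       would be a net. *)
    case: (pselect (exists t : T, True)) => [[t _]|nT].
      by exfalso; apply: not; exists t.
    by exists set0 => // t; exfalso; apply: nT; exists t.
  exists A => // t; apply: contrapT => nE; apply: not; exists t => _ a Aa Eat.
  by apply: nE; exists a.
pose c A := sval (next A).
pose A := fix A n := if n is m.+1 then A m `|` [set c (A m)] else set0.
have fA n : finite_set (A n).
  by elim: n => //= n ih; rewrite finite_setU; split.
have cA m n : (m < n)%N -> A n (c (A m)).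
  elim: n => // n ih; rewrite ltnS leq_eqVlt.
  by move=> /predU1P[->|/ih]; [right|left].
have [t tP] := countably_compact_cluster (fun n => c (A n)) Tc.
have [N Nt NE] := EN t.
have [m _ Nm] := tP N Nt 0%N.
have [n mn Nn] := tP N Nt m.+1.
exact: (svalP (next (A n)) (fA n) _ (cA _ _ mn) (NE _ _ Nm Nn)).
Qed.

(** * Oscillation of separately continuous maps *)

(** The distance between two continuous maps is continuous; in terms of balls,
    passing between nearby points enlarges the radius by an arbitrary [e]. *)
Lemma near_ball_pair (R : realType) (U : topologicalType)
    (Z : pseudoMetricType R) (g h : U -> Z) (u : U) (r e : R) :
  {for u, continuous g} -> {for u, continuous h} -> (0 < e)%R ->
  (\forall v \near u, ball (g v) r (h v) -> ball (g u) (r + e) (h u)) /\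
  (\forall v \near u, ball (g u) r (h u) -> ball (g v) (r + e) (h v)).
Proof.
move=> gu hu e0; have e20 : (0 < e / 2)%R by lra.
have re : (r + e = e / 2 + r + e / 2)%R by lra.
have /gu/= gn := nbhsx_ballx (g u) (e / 2)%R e20.
have /hu/= hn := nbhsx_ballx (h u) (e / 2)%R e20.
split; near=> v => gh; rewrite re.
- apply: (ball_triangle (y := h v)); last by apply/ball_sym; near: v.
  by apply: (ball_triangle _ gh); near: v.
- apply: (ball_triangle (y := h u)); last by near: v.
  by apply: (ball_triangle _ gh); apply/ball_sym; near: v.
Unshelve. all: by end_near.
Qed.

Definition small_oscillation (R : realType) (X Y : topologicalType)
    (Z : pseudoMetricType R) (f : X * Y -> Z) (e : R) (V : set X) : Prop :=
  forall y : Y, exists2 W : set Y, nbhs y W & forall x x' w w',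
    V x -> V x' -> W w -> W w' -> ball (f (x, w)) e (f (x', w')).

(** If all pairs that are [r]-close along [F] were [2 * d]-close on [O], then
    shrinking [O] around [x0] so that [f (_, a)] varies by at most [d] for each
    [a] in a finite net of [Y] (for closeness along [F]) would give a small set: for [w] near [y], the value
    [f (x, w)] is compared successively with [f (x, y)], [f (x, a)] and
    [f (x0, a)], at a cost of [2 * d + 2 * d + d], and the constant [10 * d] is
    twice that total. *)
Lemma exists_separating_pair (R : realType) (X Y : topologicalType)
    (Z : pseudoMetricType R) (f : X * Y -> Z) (d r : R) (F : set X)
    (O : set X) :
  countably_compact Y -> separately_continuous f ->
  (0 < d)%R -> (0 < r)%R -> finite_set F -> open O -> O !=set0 ->
  (forall V, open V -> V !=set0 -> V `<=` O ->
     ~ small_oscillation f (10 * d)%R V) ->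
  exists (p : Y * Y) (U : set X),
    [/\ open U, U !=set0, U `<=` O,
        forall x, F x -> ball (f (x, p.1)) r (f (x, p.2)) &
        forall x, U x -> ~ ball (f (x, p.1)) d (f (x, p.2))].
Proof.
move=> Yc [fX fY] d0 r0 fF oO [x0 Ox0] nosmall; apply: contrapT => nopair.
pose E y y' := forall x, F x -> ball (f (x, y)) r (f (x, y')).
have EO x y y' : O x -> E y y' -> ball (f (x, y)) (d + d)%R (f (x, y')).
  move=> Ox Eyy; apply: contrapT => nb; apply: nopair.
  have [near1 _] := near_ball_pair d (fX y x) (fX y' x) d0.
  have /nbhs_interior nU :
      nbhs x (O `&` [set z | ~ ball (f (z, y)) d (f (z, y'))]).
    apply: filterI; first exact: open_nbhs_nbhs.
    by apply: filterS near1 => z zP /zP.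
  exists (y, y'), (O `&` [set z | ~ ball (f (z, y)) d (f (z, y'))])°.
  split => //; first exact: open_interior.
  - by exists x; exact: nbhs_singleton.
  - by move=> z /interior_subset[].
  - by move=> z /interior_subset[].
have nE y : \forall y' \near y, forall x, F x ->
    ball (f (x, y)) (r / 2)%R (f (x, y')).
  apply: near_finite_set fF _ => x _; apply: (fY x y).
  by apply: nbhsx_ballx; lra.
have [|A fA AE] := @countably_compact_finite_net Y E Yc.
  move=> y.
  exists [set y' | forall x, F x -> ball (f (x, y)) (r / 2)%R (f (x, y'))].
    exact: nE.
  by move=> a b aP bP x Fx; apply: ball_splitr (aP _ Fx) (bP _ Fx).
pose V := (O `&` [set x | forall a, A a -> ball (f (x0, a)) d (f (x, a))])°.
have Vx0 : V x0.
  apply: filterI; first exact: open_nbhs_nbhs.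
  by apply: near_finite_set fA _ => a _; apply: (fX a x0); apply: nbhsx_ballx.
apply: (nosmall V (open_interior _)); first by exists x0.
  by move=> x /interior_subset[].
move=> y; have [a Aa Eay] := AE y.
exists [set w | E y w].
  by apply: filterS (nE y) => w wP x Fx; apply: le_ball (wP x Fx); lra.
have close x w : V x -> E y w -> ball (f (x0, a)) (5 * d)%R (f (x, w)).
  move=> /interior_subset[Ox Vx] Eyw.
  have -> : (5 * d = d + (d + d) + (d + d))%R by lra.
  apply: (ball_triangle (y := f (x, y))); last exact: EO.
  by apply: ball_triangle (EO _ _ _ Ox Eay); exact: Vx.
move=> x x' w w' Vx Vx' Ww Ww'.
have -> : (10 * d = 5 * d + 5 * d)%R by lra.
by apply: ball_triangle (close _ _ Vx' Ww'); apply/ball_sym/close.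
Qed.

(** * The Banach-Mazur game *)

(** In a game where, from any position [s], a move can bring [V s] inside any
    prescribed nonempty open subset, some run has a common point if it starts
    from a nonmeager set.  This is Oxtoby's argument: below each position keep a
    maximal family of moves with disjoint open sets.  By maximality the positions
    of level [n] that are kept cover a dense open set, so some point is covered
    at all levels; by disjointness it lies in only one position of each level,
    and these positions form a run. *)
Lemma nonmeager_play (X : topologicalType) (St : Type) (ok : set St)
    (V : St -> set X) (step : nat -> St -> St -> Prop) (s0 : St) :
  ok s0 -> ~ meager (V s0) -> (forall s, ok s -> open (V s)) ->
  (forall n s O, ok s -> open O -> O !=set0 -> O `<=` V s ->
     exists t, [/\ ok t, step n s t, V t !=set0 & V t `<=` O]) ->
  exists (u : nat -> St) (x : X),
    [/\ u 0%N = s0, forall n, step n (u n) (u n.+1) & forall n, V (u n) x].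
Proof.
move=> ok0 nmV oV next.
pose B n s := [set t | [/\ ok t, step n s t, V t !=set0 & V t `<=` V s]].
pose M n s := sval (ex_maximal_disjoint_subcollection V (B n s)).
have MP n s : maximal_disjoint_subcollection V (M n s) (B n s).
  by rewrite /M; case: ex_maximal_disjoint_subcollection.
have MB n s t : M n s t -> B n s t by have [+ _ _] := MP n s; apply.
have Mdense n s O : ok s -> open O -> O !=set0 -> O `<=` V s ->
    exists2 t, M n s t & V t `&` O !=set0.
  move=> oks oO O0 OV; apply: contrapT => noM.
  have disj t : M n s t -> V t `&` O = set0.
    move=> Mt; apply/eqP/negPn/negP => /set0P VO; apply: noM; by exists t.
  have [t [okt st Vt0 VtO]] := next n s O oks oO O0 OV.
  have [_ tM maxM] := MP n s.
  apply: (maxM (M n s `|` [set t])).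
  - split; first by move=> a; left.
    move=> /(_ t (or_intror erefl)) /disj VtO0.
    have [z Vz] := Vt0; have : (V t `&` O) z by split => //; exact: VtO.
    by rewrite VtO0.
  - move=> a [/MB//|->]; split => //; exact: subset_trans OV.
  move=> a b [Ma|->] [Mb|->] [z [Vaz Vbz]] //.
  - by apply: tM => //; exists z.
  - have : (V a `&` O) z by split => //; exact: VtO.
    by rewrite disj.
  - have : (V b `&` O) z by split => //; exact: VtO.
    by rewrite disj.
pose L := fix L n := if n is m.+1 then \bigcup_(s in L m) M m s else [set s0].
have Lok n t : L n t -> ok t.
  by case: n => [->//|n [s _ /MB[]]].
pose G n := \bigcup_(t in L n) V t.
have oG n : open (G n) by apply: bigcup_open => t /Lok/oV.
have Gdense n O : open O -> O !=set0 -> O `<=` V s0 -> O `&` G n !=set0.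
  move=> oO O0 OV; elim: n => [|n [z [Oz [s Ls Vz]]]].
    by have [z Oz] := O0; exists z; split => //; exists s0 => //; exact: OV.
  have [||||t Mt [w [Vw [Ow _]]]] := Mdense n s (O `&` V s).
  - exact: Lok Ls.
  - by apply: openI => //; apply/oV/(Lok _ _ Ls).
  - by exists z.
  - by move=> ? [].
  by exists w; split => //; exists t => //; exists s.
have ndG n : nowhere_dense (V s0 `\` G n).
  rewrite /nowhere_dense -subset0 => z Uz.
  pose U := (closure (V s0 `\` G n))°.
  have [w [[Vw _] Uw]] : (V s0 `\` G n) `&` U !=set0.
    exact: (interior_subset Uz) _ (nbhs_interior Uz).
  have [||w' [[Uw' Vw'] Gw']] := Gdense n (U `&` V s0) _ _ (@subIsetr _ _ _).
  - exact: openI (open_interior _) (oV _ ok0).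
  - by exists w.
  have [? [[_ nG] /nG]] :=
    interior_subset Uw' _ (open_nbhs_nbhs (conj (oG n) Gw')).
  by [].
have [x Vx Gx] : exists2 x, V s0 x & forall n, G n x.
  apply: contrapT => nox; apply: nmV.
  apply: (@meagerS _ _ (\bigcup_n (V s0 `\` G n))); last first.
    by exists (fun n => V s0 `\` G n).
  move=> x Vx; apply: contrapT => nG; apply: nox; exists x => // n.
  by apply: contrapT => nGx; apply: nG; exists n.
have Luniq n s t : L n s -> L n t -> V s x -> V t x -> s = t.
  elim: n s t => [|n ih] s t /=; first by move=> -> ->.
  move=> [a La Ma] [b Lb Mb] Vs Vt.
  have [_ _ _ sa] := MB _ _ _ Ma; have [_ _ _ tb] := MB _ _ _ Mb.
  have ab : a = b by apply: ih => //; [exact: sa|exact: tb].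
  rewrite -ab in Mb; have [_ tM _] := MP n a.
  by apply: (tM s t Ma Mb); exists x.
have Lx n : exists2 t, L n t & V t x by have [t] := Gx n; exists t.
have /choice[u uP] n : exists t, L n t /\ V t x.
  by have [t] := Lx n; exists t.
exists u, x; split => [|n|n]; [exact: (uP 0%N).1| |exact: (uP n).2].
have [[s Ls Ms] Vu] := uP n.+1.
have [_ ss _ sub] := MB _ _ _ Ms.
suff <- : s = u n by [].
by apply: (Luniq n) => //; [exact: (uP n).1|exact: sub|exact: (uP n).2].
Qed.

(** * Open subspaces of products *)

(** The sets containing a finite box around [p] form a filter that converges to
    [p] in each coordinate, hence converges to [p]. *)
Lemma prod_nbhs_box (I : choiceType) (S : I -> topologicalType)
    (p : prod_topology S) (O : set (prod_topology S)) :
  nbhs p O ->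
  exists (K : set I) (B : forall i, set (S i)),
    [/\ finite_set K, forall i, nbhs (p i) (B i) &
        forall q, (forall i, K i -> B i (q i)) -> O q].
Proof.
pose F : set_system (prod_topology S) := [set A |
  exists (K : set I) (B : forall i, set (S i)),
    [/\ finite_set K, forall i, nbhs (p i) (B i) &
        forall q, (forall i, K i -> B i (q i)) -> A q]].
have FF : Filter F.
  split.
  - exists set0, (fun i => setT); split => // i; exact: filterT.
  - move=> A A' [K [B [fK nB BA]]] [K' [B' [fK' nB' BA']]].
    exists (K `|` K'), (fun i => B i `&` B' i); split.
    + by rewrite finite_setU.
    + by move=> i; apply: filterI.
    + move=> q qP; split; [apply: BA|apply: BA'] => i Ki.
        by have [] := qP i (or_introl Ki).
      by have [] := qP i (or_intror Ki).
  - move=> A A' AA' [K [B [fK nB BA]]]; exists K, B; split => // q /BA; exact: AA'.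
suff : F --> p by apply.
apply/cvg_sup => i A [B [[C oC <-] Cp CA]].
exists [set i], (dfwith (fun j => setT) i C); split => //.
  move=> j; case: dfwithP => [|k _]; last exact: filterT.
  exact: open_nbhs_nbhs.
by move=> q /(_ i erefl); rewrite dfwithin => Cq; exact: CA.
Qed.

Section OpenSubspaceOfProduct.
Variables (I : choiceType) (S : I -> topologicalType) (X : topologicalType).
Variable e : X -> prod_topology S.

(** Quantifying over all points [q] of the product, and not only over those in
    the range of [e], ensures that changing coordinates outside [J] never leads
    out of the subspace. *)
Definition depends_on (J : set I) (V : set X) : Prop :=
  forall x q, V x -> (forall i, J i -> q i = e x i) ->
  exists2 x', V x' & e x' = q.

Hypothesis e_continuous : continuous e.
Hypothesis e_inj : injective e.
Hypothesis e_open : forall x O, nbhs x O -> nbhs (e x) (e @` O).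

Lemma depends_on_finite (O : set X) :
  open O -> O !=set0 ->
  exists (J : set I) (V : set X),
    [/\ finite_set J, depends_on J V, open V, V !=set0 & V `<=` O].
Proof.
move=> oO [x Ox].
have [K [B [fK nB BO]]] := prod_nbhs_box (e_open (open_nbhs_nbhs (conj oO Ox))).
pose V := [set z | forall i, K i -> (B i)° (e z i)].
have VO : V `<=` O.
  move=> z Vz; have [z' Oz' /e_inj <-//] : (e @` O) (e z).
  by apply: BO => i /Vz; exact: interior_subset.
exists K, V; split => //.
- move=> z q Vz qz.
  have [z' Oz' z'q] : (e @` O) q.
    by apply: BO => i Ki; rewrite qz//; apply: interior_subset; exact: Vz.
  by exists z' => // i Ki; rewrite z'q qz//; exact: Vz.
- rewrite openE => z Vz; apply: near_finite_set fK _ => i Ki.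
  apply: (@e_continuous z [set q : prod_topology S | (B i)° (q i)]).
  apply: (@proj_continuous _ _ i (e z)).
  by apply: open_nbhs_nbhs; split; [exact: open_interior|exact: Vz].
- by exists x => i _; exact: nB.
Qed.

Variables (a : prod_topology S) (D : forall i, set (S i)).
Variable code : forall i, S i -> nat.
Hypothesis D_dense : forall i, dense (@D i).
Hypothesis code_inj : forall i, {in @D i &, injective (@code i)}.

(** [D i] is a countable dense set of the [i]th factor, enumerated by [code];
    restricting to codes below [n] makes the grid finite. *)
Definition grid (J : set I) (n : nat) : set X :=
  [set x | forall i, e x i = a i \/
     [/\ J i, D (e x i) & (code (e x i) < n)%N]].

(** Adding one coordinate to [J] multiplies the grid by finitely many values. *)
Lemma finite_grid (J : set I) (n : nat) : finite_set J -> finite_set (grid J n).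
Proof.
pose G (J : set I) := [set q : prod_topology S | forall i, q i = a i \/
     [/\ J i, D (q i) & (code (q i) < n)%N]].
suff fG (s : seq I) : finite_set (G [set` s]).
  move=> /finite_seqP[s ->]; apply: (@finite_preimage _ _ (G [set` s]) e) => //.
  by move=> x y _ _; exact: e_inj.
elim: s => [|i s ih].
  apply: (@sub_finite_set _ _ [set a]) => // q qG.
  by apply: functional_extensionality_dep => i; have [//|[]] := qG i.
pose C := [set c : S i | D c /\ (code c < n)%N].
have fC : finite_set C.
  apply: (@sub_finite_set _ _ (C `&` (@code i) @^-1` `I_n)).
    by move=> c [Dc cn].
  apply: card_le_finite (finite_II n).
  apply/pcard_leP; apply/injfunPex; exists (@code i) => [c [[]]//|].
  move=> c c' /set_mem[[Dc _] _] /set_mem[[Dc' _] _].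
  by apply: code_inj; exact/mem_set.
pose G' := G [set` s] `|` [set dfwith q i c | q in G [set` s] & c in C].
apply: (@sub_finite_set _ _ G'); last first.
  rewrite finite_setU; split => //; exact: finite_image2.
move=> q qG; have [qi|[_ Dq cq]] := qG i.
  left => j; have [|[/= + Dq cq]] := qG j; first by left.
  by rewrite inE => /predU1P[->|js]; [left|right].
right; exists (dfwith q i (a i)).
  move=> j; case: dfwithP => [|k ik]; first by left.
  have [|[/= + Dk ck]] := qG k; first by left.
  by rewrite inE => /predU1P[ki|js]; [rewrite ki eqxx in ik|right].
exists (q i) => //.
apply: functional_extensionality_dep => j; case: dfwithP => // k ik.
by rewrite dfwithout.
Qed.

(** A neighbourhood of [x] constrains finitely many coordinates only.  Those
    among them where [x] differs from [a] lie in some [J n], and can be moved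
    into the dense sets; all others can be set to [a]. *)
Lemma grid_dense (J : nat -> set I) (x : X) (O : set X) :
  (forall n, J n `<=` J n.+1) ->
  (forall i, e x i = a i \/ exists n, J n i) -> nbhs x O ->
  exists2 z, O z & \forall n \near \oo, grid (J n) n z.
Proof.
move=> Jmono xP /e_open /prod_nbhs_box[K [B [fK nB BO]]].
have Jle m n : (m <= n)%N -> J m `<=` J n.
  by move=> /subnK <-; elim: (n - m)%N => // k ih; exact: subset_trans (Jmono _).
pose P i c := (K i -> B i c) /\
  ((c = a i) \/ (D c /\ K i /\ exists n, J n i)).
have qP i : {c : S i | P i c}.
  apply: cid; have [Ki|nKi] := pselect (K i); last by exists (a i); split; [|left].
  have [xi|Ji] := xP i.
    by exists (a i); split => [_|]; [rewrite -xi; exact: nbhs_singleton|left].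
  have [|c [Bc Dc]] := @D_dense i _ _ (open_interior (B i)).
    by exists (e x i); exact: nB.
  by exists c; split => [_|]; [exact: interior_subset|right].
pose q : prod_topology S := fun i => sval (qP i).
have [z Oz zq] : (e @` O) q by apply: BO => i; exact: (svalP (qP i)).1.
exists z => //.
have : \forall n \near \oo, forall i, K i ->
    q i = a i \/ [/\ J n i, D (q i) & (code (q i) < n)%N].
  apply: near_finite_set fK _ => i Ki.
  have [_ [qa|[Dq [_ [m Jm]]]]] := svalP (qP i); first by apply: nearW; left.
  near=> n; right; split => //.
    by apply: Jle Jm; near: n; exact: nbhs_infty_ge.
  by near: n; exact: nbhs_infty_gt.
apply: filterS => n nP i; rewrite zq.
have [Ki|nKi] := pselect (K i); first exact: nP.
by have [_ [|[_ [/nKi]]]] := svalP (qP i); left.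
Unshelve. all: by end_near.
Qed.

End OpenSubspaceOfProduct.

(** * Joint continuity *)

(** The game: a position consists of an open subset of [O], a finite set of
    coordinates, and the pair of points of [Y] produced by the last move. *)
Lemma nonmeager_small_oscillation (R : realType) (I : choiceType)
    (S : I -> topologicalType) (X Y : topologicalType) (Z : pseudoMetricType R)
    (e : X -> prod_topology S) (f : X * Y -> Z) (d : R) (O : set X) :
  (forall i, separable (S i)) -> continuous e -> injective e ->
  (forall x O, nbhs x O -> nbhs (e x) (e @` O)) ->
  countably_compact (Y * Y)%type -> separately_continuous f -> (0 < d)%R ->
  open O -> ~ meager O ->
  exists V, [/\ open V, V !=set0, V `<=` O & small_oscillation f (10 * d)%R V].
Proof.
move=> sepS e_cont e_inj e_open YYc f_sep d0 oO nmO.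
apply: contrapT => nosmall.
have [fX fY] := f_sep.
have {}nosmall V : open V -> V !=set0 -> V `<=` O ->
    ~ small_oscillation f (10 * d)%R V.
  by move=> oV V0 VO sV; apply: nosmall; exists V.
have [x0 Ox0] : O !=set0.
  apply/set0P/eqP => O0; apply: nmO; rewrite O0.
  by apply: nowhere_dense_meager; rewrite /nowhere_dense closure0 interior0.
(* The pair in the initial position is arbitrary, but [Y] must be inhabited. *)
have [y0 _] : exists y : Y, True.
  apply: contrapT => noy; apply: (nosmall O) => //; first by exists x0.
  by move=> y; exfalso; apply: noy; exists y.
pose a := e x0.
have sepP i : {Dc : set (S i) * (S i -> nat) |
    dense Dc.1 /\ {in Dc.1 &, injective Dc.2}}.
  by apply: cid; have [D /countable_injP[c cinj] Dd] := sepS i; exists (D, c).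
pose D i := (sval (sepP i)).1; pose code i := (sval (sepP i)).2.
have D_dense i : dense (D i) := (svalP (sepP i)).1.
have code_inj i : {in D i &, injective (code i)} := (svalP (sepP i)).2.
pose gr := grid e a D code.
pose St := (set X * set I * (Y * Y))%type.
pose V (s : St) := s.1.1; pose J (s : St) := s.1.2; pose p (s : St) := s.2.
pose ok (s : St) := [/\ open (V s), V s `<=` O & finite_set (J s)].
pose step n (s t : St) := [/\ J s `<=` J t, depends_on e (J t) (V t),
  forall x, gr (J s) n x ->
    ball (f (x, (p t).1)) (n.+1%:R^-1)%R (f (x, (p t).2)) &
  forall x, V t x -> ~ ball (f (x, (p t).1)) d (f (x, (p t).2))].
have [|//|s []//||u [x [_ ustep uV]]] :=
  @nonmeager_play X St ok V step (O, set0, (y0, y0)).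
- by split => //; exact: finite_set0.
- move=> n s W [_ VO fJ] oW W0 WV.
  have [|||q [U [oU U0 UW qclose qfar]]] :=
    @exists_separating_pair R X Y Z f d (n.+1%:R^-1)%R (gr (J s) n) W
      (@countably_compact_fst Y YYc) f_sep d0 _ _ oW W0.
  + by rewrite invr_gt0.
  + exact: finite_grid.
  + by move=> V' oV' V'0 V'W; apply: nosmall => // ? /V'W /WV /VO.
  have [K [V' [fK KV' oV' V'0 V'U]]] :=
    depends_on_finite e_cont e_inj e_open oU U0.
  exists (V', J s `|` K, q); split => //=.
  + split => //=; last by rewrite finite_setU.
    by move=> ? /V'U /UW /WV /VO.
  + split => //= [i|z w V'z zw|z /V'U]; [by left| |exact: qfar].
    by apply: KV' V'z _ => i Ki; apply: zw; right.
  + exact: subset_trans UW.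
pose q : prod_topology S :=
  fun i => if pselect (exists n, J (u n) i) then e x i else a i.
(* Only the sets reached by a move, those of index [n.+1], are known to depend
   on finitely many coordinates. *)
have Vq n : exists2 x', V (u n.+1) x' & e x' = q.
  have [_ dep _ _] := ustep n; apply: dep (uV _) _ => i Ji.
  by rewrite /q; case: pselect => // nJ; exfalso; apply: nJ; exists n.+1.
have [x' _ x'q] := Vq 0%N.
have {Vq}Vx' n : V (u n.+1) x'.
  by have [z Vz zq] := Vq n; rewrite (e_inj x' z)// x'q.
have [[y y'] yP] :=
  @countably_compact_cluster (Y * Y)%type (fun n => p (u n.+1)) YYc.
have pair_cont z (k : bool) :
    {for (y, y'), continuous (fun w : Y * Y => f (z, if k then w.1 else w.2))}.
  case: k.
    apply: (@continuous_comp _ _ _ fst (fun w => f (z, w))); last exact: fY.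
    exact: cvg_fst.
  apply: (@continuous_comp _ _ _ snd (fun w => f (z, w))); last exact: fY.
  exact: cvg_snd.
have close_grid z r : (\forall n \near \oo, gr (J (u n)) n z) -> (0 < r)%R ->
    ball (f (z, y)) r (f (z, y')).
  move=> gz r0; have r20 : (0 < r / 2)%R by lra.
  have [near1 _] :=
    near_ball_pair (r / 2)%R (pair_cont z true) (pair_cont z false) r20.
  have [m _ mP] : \forall n \near \oo,
      gr (J (u n)) n z /\ (n.+1%:R^-1 < r / 2)%R.
    near=> n; split; first by near: n.
    by near: n; exact: near_infty_natSinv_lt (PosNum r20).
  have [n mn /= bn] := yP _ near1 m.
  have [gn nr] := mP n mn.
  have -> : (r = r / 2 + r / 2)%R by lra.
  apply: bn; apply: (le_ball (ltW nr)).
  by have [_ _ + _] := ustep n; apply.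
have close_x' : ball (f (x', y)) (d / 2)%R (f (x', y')).
  have d40 : (0 < d / 4)%R by lra.
  have [near1 _] := near_ball_pair (d / 4)%R (fX y x') (fX y' x') d40.
  have [||z zP gz] :=
    grid_dense e_open code D_dense (a := a) (J := J \o u) _ _ near1.
  - by move=> n; have [] := ustep n.
  - by move=> i; rewrite x'q /q; case: pselect => ?; [right|left].
  have -> : (d / 2 = d / 4 + d / 4)%R by lra.
  by apply: zP; exact: close_grid.
have d20 : (0 < d / 2)%R by lra.
have [_ near2] :=
  near_ball_pair (d / 2)%R (pair_cont x' true) (pair_cont x' false) d20.
have [n _ /= /(_ close_x')] := yP _ near2 0%N.
have -> : (d / 2 + d / 2 = d)%R by lra.
by have [_ _ _ far] := ustep n; exact: far.
Unshelve. all: by end_near.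
Qed.

(** For each [d] the union of the small open sets has a closed complement, whose
    interior has no nonempty small open subset and is therefore meager. *)
Lemma residual_of_small_oscillation (R : realType) (X Y : topologicalType)
    (Z : pseudoMetricType R) (f : X * Y -> Z) :
  (forall (d : R) (O : set X), (0 < d)%R -> open O -> ~ meager O ->
     exists V, [/\ open V, V !=set0, V `<=` O &
                   small_oscillation f (10 * d)%R V]) ->
  exists Res : set X, residual Res /\
    forall x y, Res x -> {for (x, y), continuous f}.
Proof.
move=> small.
pose A (d : R) :=
  \bigcup_(V in [set V | open V /\ small_oscillation f (10 * d)%R V]) V.
have oA d : open (A d) by apply: bigcup_open => V [].
have mA d : (0 < d)%R -> meager (~` A d).
  move=> d0; apply: closed_meager_interior; first exact: open_closedC.
  apply: contrapT => nm.
  have [V [oV [z Vz] VA sV]] := small d _ d0 (open_interior _) nm.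
  by apply: (interior_subset (VA z Vz)); exists V.
exists (\bigcap_n A (n.+1%:R^-1)%R); split.
  rewrite /residual setC_bigcap; apply: meager_bigcup => n.
  by apply: mA; rewrite invr_gt0.
move=> x y Ax; apply/cvg_ballP => r r0.
have r100 : (0 < r / 10)%R by lra.
have [n _ nr] : \forall n \near \oo, (n.+1%:R^-1 < r / 10 :> R)%R.
  exact: near_infty_natSinv_lt (PosNum r100).
have {}nr := nr n (leqnn n).
have [V [oV sV] Vx] := Ax n I.
have [W Wy WP] := sV y.
exists (V, W); first by split => //; exact: open_nbhs_nbhs.
move=> [x' y'] [/= Vx' Wy'].
apply: (@le_ball _ _ _ (10 * n.+1%:R^-1)%R).
  by move: nr; move: (n.+1%:R^-1)%R => k; lra.
by apply: WP => //; exact: nbhs_singleton.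
Qed.

Theorem theorem2p5 (R : realType) (X Y : topologicalType)
    (Z : pseudoMetricType R) (Xo : set X) (f : (Xo * Y)%type -> Z)
    (X_pi_separable : pi_separable X)
    (YY_countably_compact : countably_compact (Y * Y)%type)
    (Xo_open : open Xo) (Xo_nonempty : Xo !=set0)
    (f_sep : separately_continuous f) :
  exists Res : set Xo, residual Res /\
    forall (x : Xo) (y : Y), Res x -> {for (x, y), continuous f}.
Proof.
have [I [S [sepS [h [g [h_cont g_cont hK gK]]]]]] := X_pi_separable.
(* Coordinates are compared and collected in finite sets, whence the classical
   choice structure on the index type. *)
pose e (x : Xo) : prod_topology (S : {classic I} -> topologicalType) :=
  h (set_val x).
apply: residual_of_small_oscillation => d O d0 oO nmO.
apply: (@nonmeager_small_oscillation R {classic I} S Xo Y Z e) => //.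
- move=> x; apply: (@continuous_comp _ _ _ set_val h); last exact: h_cont.
  exact: initial_continuous.
- by move=> x x' /(can_inj hK); exact: val_inj.
- move=> x O' [B [[C oC CB] Bx] BO'].
  apply: (@filterS _ _ _ (g @^-1` (C `&` Xo))).
    move=> q [Cq Xq]; exists (SigSub (mem_set Xq)); last first.
      by rewrite /e /= gK.
    by apply: BO'; rewrite -CB.
  apply: g_cont; rewrite /e hK; apply: open_nbhs_nbhs; split; first exact: openI.
  split; first by move: Bx; rewrite -CB.
  exact: set_valP.
Qed.
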